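(* Let $G,G'\in\mathcal{D}^+$ and let $\alpha,\alpha'>0$. Let $(V,G,\alpha)$ and $(V,G',\alpha')$ be two $\alpha$-simple spaces (with exponents $\alpha$ and $\alpha'$ respectively), regarded as PN spaces. A linear operator $T:(V,G,\alpha)\to(V,G',\alpha')$ is continuous (for the strong topologies) if and only if $T$ is bounded.
   Context: $\Delta^+$ is the set of distance distribution functions, i.e. nondecreasing functions $F:[-\infty,+\infty]\to[0,1]$, left-continuous on $\mathbb{R}$, with $F(0)=0$ and $F(+\infty)=1$; $\mathcal{D}^+$ is the set of $F\in\Delta^+$ with $\lim_{x\to+\infty}F(x)=1$. $\varepsilon_0(x)=0$ for $x\le0$ and $1$ for $x>0$; $\varepsilon_\infty$ is the element of $\Delta^+$ that is $0$ at every finite point. Given a real normed space $(V,\|\cdot\|)$, $G\in\Delta^+$ different from $\varepsilon_0$ and $\varepsilon_\infty$, and an exponent $\alpha$, the $\alpha$-simple space $(V,G,\alpha)$ generated by $(V,\|\cdot\|)$ and $G$ is $V$ with the probabilistic norm $\nu:V\to\Delta^+$ given by $\nu_\theta=\varepsilon_0$ and $\nu_p(t)=G(t/\|p\|^\alpha)$ for $p\ne\theta$. For $\alpha>0$ it is regarded as the PN space $(V,\nu,\tau_{M,L},\tau_{M,L})$, where $L(x,y)=(x^{1/\alpha}+y^{1/\alpha})^\alpha$ and $\tau_{M,L}(F,H)(x)=\sup\{\min(F(u),H(v)):L(u,v)=x\}$. The strong topology has as neighborhood base at $q$ the sets $q+N_\theta(t)$, $t>0$, where $N_\theta(t)=\{p:\nu_p(t)>1-t\}$.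 A subset $A$ is bounded if for every integer $m\ge1$ there are a finite set $A_1\subseteq A$ and a natural number $k\ge1$ with $A\subseteq\bigcup_{p\in A_1}(p+N_\theta(1/m)^{[k]})$, where $B^{[k]}=B+\cdots+B$ ($k$ summands). A linear operator is bounded if it maps bounded subsets to bounded subsets. *)

(* Defs.v *)
From HB Require Import structures.
From mathcomp Require Import all_boot all_order all_algebra.
From mathcomp Require Import all_classical all_reals all_analysis.

Set Implicit Arguments.
Unset Strict Implicit.
Unset Printing Implicit Defensive.

Import Order.TTheory GRing.Theory Num.Theory.
Import numFieldNormedType.Exports.

Local Open Scope classical_set_scope.
Local Open Scope ring_scope.

(* The set Delta^+ of distance distribution functions. *)
Record ddf (R : realType) := Ddf {
  ddf_fun :> \bar R -> R ;
  ddf_ge0 : forall x, 0 <= ddf_fun x ;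
  ddf_le1 : forall x, ddf_fun x <= 1 ;
  ddf_homo : {homo ddf_fun : x y / (x <= y)%E >-> x <= y} ;
  ddf_left_cont : forall x : R,
    ddf_fun y%:E @[y --> x^'-] --> ddf_fun x%:E ;
  ddf_at0 : ddf_fun 0%E = 0 ;
  ddf_aty : ddf_fun +oo%E = 1
}.

(* The subset D^+ of Delta^+. *)
Definition in_Dplus (R : realType) (F : ddf R) : Prop :=
  F x%:E @[x --> +oo] --> (1 : R).

Section ddf_constructions.
Variable R : realType.
Implicit Types (F G H : ddf R).

Lemma left_contP (f : \bar R -> R) (x : R) :
  {homo f : x y / (x <= y)%E >-> x <= y} ->
  (f y%:E @[y --> x^'-] --> f x%:E) <->
  (forall e, 0 < e -> exists2 y : R, y < x & f x%:E - e < f y%:E).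
Proof.
move=> fh; split.
- move=> /cvgrPdist_lt fx e e0.
  have A : \forall y \near x^'-, y < x by exact: nbhs_left_lt.
  have [y [yx fxy]] := filter_ex (filterI A (fx _ e0)).
  exists y => //; rewrite ltrBlDr -ltrBlDl.
  exact: le_lt_trans (ler_norm _) fxy.
- move=> fx; apply/cvgrPdist_lt => e e0.
  have [y0 y0x fy0] := fx e e0.
  have A : \forall y \near x^'-, y < x by exact: nbhs_left_lt.
  have B : \forall y \near x^'-, y0 < y by exact: nbhs_left_gt.
  apply: filterS (filterI A B) => y [yx y0y].
  rewrite ger0_norm ?subr_ge0 ?fh ?lee_fin 1?ltW//.
  rewrite ltrBlDr -ltrBlDl (lt_le_trans fy0)// fh// lee_fin ltW//.
Qed.

Lemma ddf_approx F (x : R) e : 0 < e ->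
  exists2 y : R, y < x & F x%:E - e < F y%:E.
Proof.
by move=> e0; apply: (left_contP x (@ddf_homo _ F)).1 e0; exact: ddf_left_cont.
Qed.

Definition eps0_fun (x : \bar R) : R := if (0 < x)%E then 1 else 0.

Definition epsy_fun (x : \bar R) : R := if x == +oo%E then 1 else 0.

Definition scale_fun G (c : R) (t : \bar R) : R := G (t * (c^-1)%:E)%E.

Lemma eps0_homo : {homo eps0_fun : x y / (x <= y)%E >-> x <= y}.
Proof.
move=> x y xy; rewrite /eps0_fun; case: ifPn => x0.
  by rewrite (lt_le_trans x0 xy).
by case: ifP.
Qed.

Lemma epsy_homo : {homo epsy_fun : x y / (x <= y)%E >-> x <= y}.
Proof.
move=> x y xy; rewrite /epsy_fun; case: eqP => [xE|_]; last by case: ifP.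
by move: xy; rewrite xE leye_eq => ->.
Qed.

Lemma scale_homo G c : 0 < c ->
  {homo scale_fun G c : x y / (x <= y)%E >-> x <= y}.
Proof.
move=> c0 x y xy; apply: ddf_homo; apply: lee_wpmul2r => //.
by rewrite lee_fin invr_ge0 ltW.
Qed.

Definition eps0 : ddf R.
Proof.
apply: (@Ddf _ eps0_fun).
- by move=> x; rewrite /eps0_fun; case: ifP.
- by move=> x; rewrite /eps0_fun; case: ifP.
- exact: eps0_homo.
- move=> x; apply: (left_contP _ eps0_homo).2 => e e0.
  have [x0|x0] := ltP 0 x.
    exists (x / 2); first by rewrite ltr_pdivrMr// ltr_pMr// ltr1n.
    by rewrite /eps0_fun !lte_fin x0 divr_gt0// gtrBl.
  exists (x - 1); first by rewrite gtrBl.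
  rewrite /eps0_fun !lte_fin (ltNge 0 x) x0/= sub0r; case: ifP => _.
    by rewrite (lt_trans _ ltr01)// oppr_lt0.
  by rewrite oppr_lt0.
- by rewrite /eps0_fun ltxx.
- by rewrite /eps0_fun ltry.
Defined.

Definition epsy : ddf R.
Proof.
apply: (@Ddf _ epsy_fun).
- by move=> x; rewrite /epsy_fun; case: ifP.
- by move=> x; rewrite /epsy_fun; case: ifP.
- exact: epsy_homo.
- move=> x; apply: (left_contP _ epsy_homo).2 => e e0.
  exists (x - 1); first by rewrite gtrBl.
  by rewrite /epsy_fun/= sub0r oppr_lt0.
- by rewrite /epsy_fun.
- by rewrite /epsy_fun eqxx.
Defined.

(* The function t |-> G (t / c). *)
Definition ddf_scale G (c : R) (c0 : 0 < c) : ddf R.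
Proof.
apply: (@Ddf _ (scale_fun G c)).
- by move=> x; exact: ddf_ge0.
- by move=> x; exact: ddf_le1.
- exact: scale_homo.
- move=> x; apply: (left_contP _ (@scale_homo G c c0)).2 => e e0.
  have [y yx Gy] := ddf_approx G (x * c^-1) e0.
  exists (y * c); first by rewrite -ltr_pdivlMr.
  by rewrite /scale_fun -!EFinM mulfK ?gt_eqF.
- by rewrite /scale_fun mul0e ddf_at0.
- by rewrite /scale_fun mulyr gtr0_sg ?invr_gt0// mul1e ddf_aty.
Defined.

End ddf_constructions.
Arguments eps0 {R}.
Arguments epsy {R}.

Section triangle_function.
Variables (R : realType) (alpha : R).
Hypothesis alpha_gt0 : 0 < alpha.
Implicit Types (F H : ddf R).

Definition Lop (x y : \bar R) : \bar R :=
  ((x `^ alpha^-1 + y `^ alpha^-1) `^ alpha)%E.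

Definition tauML_set F H (x : \bar R) : set R :=
  [set Num.min (F uv.1) (H uv.2) | uv in
    [set uv : \bar R * \bar R |
      [/\ (0 <= uv.1)%E, (0 <= uv.2)%E & Lop uv.1 uv.2 = x]]].

(* For x < 0 no pair is admissible, and sup set0 = 0. *)
Definition tauML_fun F H (x : \bar R) : R := sup (tauML_set F H x).

Let a_gt0 : 0 < alpha^-1. Proof. by rewrite invr_gt0. Qed.

Let powK (x : \bar R) : (0 <= x)%E -> ((x `^ alpha) `^ alpha^-1 = x)%E.
Proof. by move=> x0; rewrite -poweRrM mulfV ?gt_eqF// poweRe1. Qed.

Let powVK (x : \bar R) : (0 <= x)%E -> ((x `^ alpha^-1) `^ alpha = x)%E.
Proof. by move=> x0; rewrite -poweRrM mulVf ?gt_eqF// poweRe1. Qed.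

Lemma tauML_ub F H x : ubound (tauML_set F H x) 1.
Proof. by move=> _ [uv _ <-]; rewrite ge_min ddf_le1. Qed.

Lemma tauML_mem F H x y : tauML_set F H x y -> y <= tauML_fun F H x.
Proof. by move=> Sy; apply: ub_le_sup => //; exists 1; exact: tauML_ub. Qed.

Lemma tauML_nonempty F H x : (0 <= x)%E -> tauML_set F H x !=set0.
Proof.
move=> x0; exists (Num.min (F x) (H 0%E)); exists (x, 0%E) => //=; split => //.
by rewrite /Lop poweR0r ?gt_eqF// adde0 powVK.
Qed.

Lemma tauML_lt0 F H x : (x < 0)%E -> tauML_fun F H x = 0.
Proof.
move=> x0; rewrite /tauML_fun (_ : tauML_set F H x = set0) ?sup0//.
apply/seteqP; split => // y [uv [_ _ uvx] _].
by move: x0; rewrite -uvx ltNge poweR_ge0.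
Qed.

Lemma tauML_ge0 F H x : 0 <= tauML_fun F H x.
Proof.
have [x0|x0] := leP 0%E x; last by rewrite tauML_lt0.
have [y Sy] := tauML_nonempty F H x0.
apply: le_trans (tauML_mem Sy).
by case: Sy => uv _ <-; rewrite le_min !ddf_ge0.
Qed.

Lemma tauML_le1 F H x : tauML_fun F H x <= 1.
Proof.
have [x0|x0] := leP 0%E x; last by rewrite tauML_lt0.
by apply: ge_sup (tauML_nonempty F H x0) _; exact: tauML_ub.
Qed.

Lemma tauML_homo F H :
  {homo tauML_fun F H : x y / (x <= y)%E >-> x <= y}.
Proof.
move=> x y xy; have [x0|x0] := leP 0%E x; last first.
  by rewrite tauML_lt0// tauML_ge0.
apply: ge_sup (tauML_nonempty F H x0) _ => _ [[u v] /= [u0 v0 uvx] <-].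
case: u u0 uvx => [u| |] //= u0 uvx; last first.
  apply: tauML_mem; exists (+oo%E, v) => //=; split => //.
  have xE : x = +oo%E.
    rewrite -uvx /Lop (eqy_poweR a_gt0 erefl) addye.
      exact: eqy_poweR.
    by rewrite -ltNye (lt_le_trans _ (poweR_ge0 _ _)).
  by move: xy; rewrite uvx xE leye_eq => /eqP ->.
pose w := ((y `^ alpha^-1 - u%:E `^ alpha^-1) `^ alpha)%E.
have ufin : (u%:E `^ alpha^-1)%E \is a fin_num by exact: fin_num_poweR.
have y0 : (0 <= y)%E := le_trans x0 xy.
have xE : (u%:E `^ alpha^-1 + v `^ alpha^-1 = x `^ alpha^-1)%E.
  by rewrite -uvx /Lop powK// adde_ge0// poweR_ge0.
have vy : (v `^ alpha^-1 <= y `^ alpha^-1 - u%:E `^ alpha^-1)%E.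
  rewrite leeBrDl// xE.
  by apply: gt0_ler_poweR; rewrite ?in_itv/= ?x0 ?y0 ?leey// ltW.
have d0 := le_trans (poweR_ge0 v alpha^-1) vy.
have vw : (v <= w)%E.
  rewrite -[leLHS]powVK//.
  by apply: gt0_ler_poweR; rewrite ?in_itv/= ?poweR_ge0 ?d0 ?leey// ltW.
apply: (@le_trans _ _ (Num.min (F u%:E) (H w))).
  by rewrite le_min ge_min lexx/= ge_min (ddf_homo _ vw) orbT.
apply: tauML_mem; exists (u%:E, w) => //=; split => //; first exact: poweR_ge0.
by rewrite /Lop powK// addeC subeK// powVK.
Qed.

Lemma tauML_approx F H (x : R) e : 0 < e ->
  exists2 y : R, y < x & tauML_fun F H x%:E - e < tauML_fun F H y%:E.
Proof.
move=> e0.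
have triv : tauML_fun F H x%:E < e ->
    exists2 y : R, y < x & tauML_fun F H x%:E - e < tauML_fun F H y%:E.
  move=> h; exists (x - 1); first by rewrite gtrBl.
  by apply: lt_le_trans (tauML_ge0 _ _ _); rewrite subr_lt0.
have [x0|x0] := ltP x 0; first by apply: triv; rewrite tauML_lt0.
have := sup_adherent e0 (conj (tauML_nonempty F H (x0 : (0 <= x%:E)%E))
  (ex_intro _ 1 (@tauML_ub F H x%:E))).
move=> -[_ [[u v] /= [u0 v0 uvx] <-]]; rewrite -/(tauML_fun F H x%:E) lt_min.
have Lfin : (u `^ alpha^-1 + v `^ alpha^-1 < +oo)%E.
  apply: (@lty_poweRy _ _ alpha); first by rewrite gt_eqF.
  by rewrite -/(Lop u v) uvx ltry.
have : (u < +oo)%E.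
  apply: (@lty_poweRy _ _ alpha^-1); first by rewrite gt_eqF.
  by apply: le_lt_trans Lfin; rewrite leeDl// poweR_ge0.
have : (v < +oo)%E.
  apply: (@lty_poweRy _ _ alpha^-1); first by rewrite gt_eqF.
  by apply: le_lt_trans Lfin; rewrite leeDr// poweR_ge0.
case: v v0 uvx Lfin => // v v0 uvx Lfin _.
case: u u0 uvx Lfin => // u u0 uvx _ _.
rewrite lee_fin in u0; rewrite lee_fin in v0.
move=> /andP[Fu Hv].
have [uE|un0] := eqVneq u 0.
  by move: Fu; rewrite uE ddf_at0 subr_lt0 => /triv.
have [vE|vn0] := eqVneq v 0.
  by move: Hv; rewrite vE ddf_at0 subr_lt0 => /triv.
have dec (K : ddf R) (w : R) : 0 <= w -> w != 0 ->
    tauML_fun F H x%:E - e < K w%:E ->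
    exists w', [/\ 0 <= w', w' < w & tauML_fun F H x%:E - e < K w'%:E].
  move=> w0 wn0 Kw; move: (Kw); rewrite -subr_gt0 => d0.
  have [w' w'w] := ddf_approx K w d0; rewrite opprB addrC subrK => Kw'.
  exists (Num.max w' 0); split; first by rewrite le_max lexx orbT.
    by rewrite gt_max w'w/= lt_neqAle eq_sym wn0.
  by apply: lt_le_trans Kw' _; apply: ddf_homo; rewrite lee_fin le_max lexx.
have [u' [u'0 u'u Fu']] := dec F u u0 un0 Fu.
have [v' [v'0 v'v Hv']] := dec H v v0 vn0 Hv.
exists ((u' `^ alpha^-1 + v' `^ alpha^-1) `^ alpha).
  move: uvx => -[<-].
  have powlt (s t : R) : 0 <= s -> s < t -> s `^ alpha^-1 < t `^ alpha^-1.
    by move=> s0 st; rewrite gt0_ltr_powR// nnegrE// (le_trans s0)// ltW.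
  by rewrite gt0_ltr_powR ?nnegrE ?addr_ge0 ?powR_ge0// ltrD ?powlt.
apply: (@lt_le_trans _ _ (Num.min (F u'%:E) (H v'%:E))).
  by rewrite lt_min Fu'.
by apply: tauML_mem; exists (u'%:E, v'%:E).
Qed.

Definition tauML F H : ddf R.
Proof.
apply: (@Ddf _ (tauML_fun F H)).
- exact: tauML_ge0.
- exact: tauML_le1.
- exact: tauML_homo.
- move=> x; apply: (left_contP _ (@tauML_homo F H)).2 => e e0.
  exact: tauML_approx.
- apply/eqP; rewrite eq_le tauML_ge0 andbT.
  apply: ge_sup (tauML_nonempty F H (lexx _)) _ => _ [[u v] /= [u0 v0 uv0] <-].
  have /eqP := poweR_eq0_eq0 (adde_ge0 (poweR_ge0 u _) (poweR_ge0 v _)) uv0.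
  rewrite padde_eq0 ?poweR_ge0// => /andP[/eqP/(poweR_eq0_eq0 u0) -> _].
  by rewrite ge_min ddf_at0 lexx.
- apply/eqP; rewrite eq_le tauML_le1/=; apply: tauML_mem.
  exists (+oo%E, +oo%E) => /=; last by rewrite !ddf_aty minxx.
  by split=> //; rewrite /Lop !eqy_poweR.
Defined.

End triangle_function.

(* The quadruple (V, nu, tau, tau^star) of a probabilistic normed space, without
   its axioms: the strong topology and boundedness only depend on nu. *)
Record pnSpace (R : realType) (V : lmodType R) := PnSpace {
  pnorm : V -> ddf R ;
  pn_tau : ddf R -> ddf R -> ddf R ;
  pn_taustar : ddf R -> ddf R -> ddf R
}.

(* An alias of V carrying the strong topology; it does not inherit the norm
   topology when V is a normed module. *)
Definition pn_carrier (R : realType) (V : lmodType R) (X : pnSpace V) : Type :=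
  V.
Coercion pn_carrier : pnSpace >-> Sortclass.

HB.instance Definition _ (R : realType) (V : lmodType R) (X : pnSpace V) :=
  GRing.Lmodule.copy (pn_carrier X) V.

Section strong_topology.
Variables (R : realType) (V : lmodType R) (X : pnSpace V).

Definition strong_ball (t : R) : set X :=
  [set p : X | 1 - t < pnorm X p t%:E].

Definition strong_nbhs (q : X) : set_system X :=
  filter_from [set t : R | 0 < t] (fun t => [set q + p | p in strong_ball t]).

HB.instance Definition _ := hasNbhs.Build (pn_carrier X) strong_nbhs.

(* B + ... + B with k summands. *)
Definition iter_sumset (B : set X) (k : nat) : set X :=
  [set p | exists2 x : 'I_k -> X,
    forall i, B (x i) & p = \sum_(i < k) x i].

Definition pn_bounded (A : set X) : Prop :=
  forall m : nat, (0 < m)%N ->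
    exists (A1 : set X) (k : nat),
      [/\ finite_set A1, A1 `<=` A, (0 < k)%N &
          A `<=` \bigcup_(p in A1)
                   [set p + q | q in iter_sumset (strong_ball m%:R^-1) k]].

End strong_topology.

Definition bounded_operator (R : realType) (V W : lmodType R)
    (X : pnSpace V) (Y : pnSpace W) (T : X -> Y) : Prop :=
  forall A : set X, pn_bounded A -> pn_bounded (T @` A).

Section alpha_simple.
Variables (R : realType) (V : normedModType R) (G : ddf R) (alpha : R).

Lemma norm_powR_gt0 (p : V) : p != 0 -> 0 < `|p| `^ alpha.
Proof. by move=> p0; rewrite powR_gt0// normr_gt0. Qed.

Definition simple_pnorm (p : V) : ddf R :=
  match boolP (p != 0) with
  | AltTrue p0 => ddf_scale G (norm_powR_gt0 p0)
  | AltFalse _ => eps0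
  end.

Lemma simple_pnorm0 : simple_pnorm 0 = eps0.
Proof.
by rewrite /simple_pnorm; case: {-}_ / boolP => // p0; case/eqP: (p0).
Qed.

Lemma simple_pnormE (p : V) (t : \bar R) : p != 0 ->
  simple_pnorm p t = G (t * ((`|p| `^ alpha)^-1)%:E)%E.
Proof.
by rewrite /simple_pnorm; case: {-}_ / boolP => // /negPf ->.
Qed.

Definition alpha_simple (alpha_gt0 : 0 < alpha) : pnSpace V :=
  PnSpace simple_pnorm (tauML alpha_gt0) (tauML alpha_gt0).

End alpha_simple.

(* Main.v *)
Require Import Defs.
From mathcomp Require Import all_boot all_order all_algebra.
From mathcomp Require Import all_classical all_reals all_analysis.
Import Order.TTheory GRing.Theory Num.Theory.
Import numFieldNormedType.Exports.
Local Open Scope classical_set_scope.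
Local Open Scope ring_scope.

(** Both sides of the equivalence are notions of the normed space [V].

    For [p != 0] the condition [G (t / |p|^alpha) > 1 - t] bounds [|p|] on both
    sides.  Since [G] tends to [1], it exceeds [1 - t] at some [x > 0], so every
    [p] with [|p|^alpha < t / x] lies in the strong ball of radius [t]
    ([norm_ball_sub_strong_ball]).  Since [G <> eps0], there is [x > 0] with
    [G x < 1], and once [t < 1 - G x], membership in the strong ball forces
    [|p|^alpha < t / x], which tends to [0] with [t]
    ([strong_ball_sub_norm_ball]).

    Hence the strong topology is the norm topology ([strong_nbhsE]).  The same
    two inclusions show that a set is bounded exactly when it is bounded in norm
    ([pn_boundedP]): a sum of [k] vectors of norm less than [r] has norm at most
    [k r], and conversely a vector [p] of norm less than [k r] is the sum of [k]
    copies of [p / k].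

    Neither description mentions [G] or [alpha], so the theorem is the
    classical fact that a linear map of normed spaces is continuous if and
    only if it maps norm-bounded sets to norm-bounded sets. *)

Lemma ddf_lt1_pos (R : realType) (G : ddf R) :
  G <> eps0 -> exists2 x : R, 0 < x & G x%:E < 1.
Proof.
move=> G0; apply: contrapT => noG; apply: G0.
suff GE : ddf_fun G = ddf_fun eps0.
  case: G noG GE => g g1 g2 g3 g4 g5 g6 _ /= gE.
  by subst g; rewrite /eps0; congr Ddf; exact: Prop_irrelevance.
apply/funext => x; apply/eqP; rewrite eq_le /= /eps0_fun; case: ifPn => [x0|].
  rewrite ddf_le1 /=; case: x x0 => [x x0|_|//]; last by rewrite ddf_aty.
  by rewrite leNgt; apply/negP => Gx; apply: noG; exists x.
by rewrite -leNgt ddf_ge0 andbT -(ddf_at0 G) => x0; exact: ddf_homo.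
Qed.

Section one_space.
Variables (R : realType) (V : normedModType R) (G : ddf R) (alpha : R).
Hypothesis alpha_gt0 : 0 < alpha.
Let X := alpha_simple V G alpha_gt0.

(** Some [x > 0] has [G x > 1 - t], and the norm ball of radius
    [(t / x)^(1 / alpha)] consists of the [p] with [t / |p|^alpha > x],
    together with [0]. *)
Lemma norm_ball_sub_strong_ball (GD : in_Dplus G) (t : R) : 0 < t ->
  exists2 r : R, 0 < r & forall p : V, `|p| < r -> strong_ball (X := X) t p.
Proof.
move=> t0; rewrite /strong_ball /=.
have /cvgrPdist_lt/(_ t t0) := GD.
move=> /pinfty_ex_gt0[x /= x0 Gx].
have {}Gx : 1 - t < G x%:E.
  by rewrite ltrBlDr -ltrBlDl; apply: le_lt_trans Gx; exact: ler_norm.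
exists ((t / x) `^ alpha^-1); first by rewrite powR_gt0 ?divr_gt0.
move=> p pr; have [->|p0] := eqVneq p 0.
  by rewrite simple_pnorm0 /= /eps0_fun lte_fin t0 gtrBl.
rewrite simple_pnormE//; apply: lt_le_trans Gx _; apply: ddf_homo.
rewrite -EFinM lee_fin ler_pdivlMr ?norm_powR_gt0// mulrC -ler_pdivlMr//.
have -> : t / x = ((t / x) `^ alpha^-1) `^ alpha.
  by rewrite -powRrM mulVf ?gt_eqF// powRr1 ?divr_ge0 ?ltW.
by rewrite ge0_ler_powR ?nnegrE ?powR_ge0 ?normr_ge0 ?ltW.
Qed.

(** The radius is taken of the form [1 / m] because boundedness only tests such
    radii; these are also enough to compare the topologies. *)
Lemma strong_ball_sub_norm_ball (G0 : G <> eps0) (r : R) : 0 < r ->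
  exists2 m : nat, (0 < m)%N &
    forall p : V, strong_ball (X := X) m%:R^-1 p -> `|p| < r.
Proof.
move=> r0; have [x x0 Gx] := ddf_lt1_pos _ _ G0.
(* With [t = 1 / m] below both bounds, [|p| >= r] would give
   [t / |p|^alpha <= x], hence [G (t / |p|^alpha) <= G x < 1 - t]. *)
have e0 : 0 < Num.min (1 - G x%:E) (r `^ alpha * x).
  by rewrite lt_min subr_gt0 Gx mulr_gt0 ?powR_gt0.
have [m] := ltr_add_invr e0; rewrite add0r lt_min => /andP[mG mr].
exists m.+1 => // p; rewrite /strong_ball /=; set t := m.+1%:R^-1 in mG mr *.
have [->|p0] := eqVneq p 0; first by rewrite normr0.
rewrite simple_pnormE// => Gt; rewrite ltNge; apply/negP => rp.
move: Gt; apply/negP; rewrite -leNgt; apply: (@le_trans _ _ (G x%:E)).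
  apply: ddf_homo; rewrite -EFinM lee_fin ler_pdivrMr ?norm_powR_gt0//.
  apply: (le_trans (ltW mr)); rewrite mulrC ler_pM2l//.
  by apply: ge0_ler_powR; rewrite ?nnegrE ?normr_ge0 // ltW.
by rewrite lerBrDl -lerBrDr ltW.
Qed.

Lemma strong_nbhsE (GD : in_Dplus G) (G0 : G <> eps0) (q : V) :
  strong_nbhs (X := X) q = nbhs q.
Proof.
apply/seteqP; split => A.
  move=> [t /= t0 tA]; apply/nbhs_normP.
  have [r r0 rt] := norm_ball_sub_strong_ball GD _ t0.
  exists r => // p /= qp; apply: tA; exists (p - q : V).
    by apply: rt; rewrite distrC.
  by rewrite (addrC (q : V)); exact: (@subrK V).
move=> /nbhs_normP[r /= r0 rA].
have [m m0 mr] := strong_ball_sub_norm_ball G0 _ r0.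
exists m%:R^-1 => /=; first by rewrite invr_gt0 ltr0n.
move=> _ [p /mr pr <-]; apply: rA => /=.
by rewrite -normrN opprB (addrC (q : V)) (@addrK V).
Qed.

Lemma iter_sumset_norm_le (r : R) (B : set X) (k : nat) :
  (forall p : V, B p -> `|p| < r) ->
  forall p : V, iter_sumset (X := X) B k p -> `|p| <= r *+ k.
Proof.
move=> Br p [x Bx ->]; rewrite (le_trans (@ler_norm_sum R V _ _ _ _))//.
rewrite -[X in _ *+ X]card_ord -sumr_const ler_sum// => i _.
by apply/ltW/Br.
Qed.

Lemma norm_lt_iter_sumset (r : R) (B : set X) (k : nat) :
  (0 < k)%N -> (forall p : V, `|p| < r -> B p) ->
  forall p : V, `|p| < r *+ k -> iter_sumset (X := X) B k p.
Proof.
move=> k0 rB p pr; exists (fun=> k%:R^-1 *: (p : V)).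
  move=> _; apply: rB; rewrite normrZ gtr0_norm ?invr_gt0 ?ltr0n//.
  by rewrite mulrC ltr_pdivrMr ?ltr0n// mulr_natr.
rewrite (@sumr_const V) card_ord -scaler_nat.
by rewrite (@scalerA _ V) mulfV ?scale1r// pnatr_eq0 -lt0n.
Qed.

(** A norm-bounded set is covered by a single translate of [B^[k]], centred at
    any of its points; conversely, the one radius [1 / m] whose strong ball lies
    in the unit norm ball already gives a bound. *)
Lemma pn_boundedP (GD : in_Dplus G) (G0 : G <> eps0) (A : set V) :
  pn_bounded (X := X) A <-> exists M : R, forall p : V, A p -> `|p| <= M.
Proof.
split=> [bA|[M AM] m m0].
  have [m m0 m1] := strong_ball_sub_norm_ball G0 _ ltr01.
  have [A1 [k [A1fin _ _ Acov]]] := bA m m0.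
  have [N [_ /(_ (N + 1))]] := @compact_bounded R V A1 (finite_compact A1fin).
  rewrite ltrDl ltr01 => /(_ isT) A1N.
  exists ((N + 1) + 1 *+ k) => p /Acov[a A1a [q qk <-]].
  rewrite (le_trans (@ler_normD R V _ _))// lerD//; first exact: A1N.
  exact: iter_sumset_norm_le m1 _ qk.
have [->|/set0P[a Aa]] := eqVneq A set0.
  by exists set0, 1%N; split.
have [|r r0 rm] := norm_ball_sub_strong_ball GD m%:R^-1.
  by rewrite invr_gt0 ltr0n.
(* [|a| + M] bounds the distance from [a] to the points of [A]. *)
have [k kM] : exists k, (`|a| + M) / r < k.+1%:R.
  exists (Num.truncn ((`|a| + M) / r)); exact: truncnS_gt.
exists [set a], k.+1; split => //; first by move=> _ ->.
move=> p Ap; exists a => //; exists (p - a : V); last first.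
  by rewrite (addrC (a : V)); exact: (@subrK V).
apply: norm_lt_iter_sumset rm _ _ => //.
rewrite -mulr_natl -ltr_pdivrMr//; apply: le_lt_trans kM.
rewrite ler_pM2r ?invr_gt0// distrC.
by apply: le_trans (ler_normB _ _) _; rewrite lerD2l; exact: AM.
Qed.

End one_space.

Theorem corollary3p7 (R : realType) (V : normedModType R)
    (G G' : ddf R) (alpha alpha' : R)
    (alpha_gt0 : 0 < alpha) (alpha'_gt0 : 0 < alpha')
    (GD : in_Dplus G) (G'D : in_Dplus G')
    (G0 : G <> eps0) (Gy : G <> epsy)
    (G'0 : G' <> eps0) (G'y : G' <> epsy)
    (T : {linear alpha_simple V G alpha_gt0 -> alpha_simple V G' alpha'_gt0}) :
  continuous T <-> bounded_operator T.
Proof.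
(* [T] seen as a linear map for the norm structure of [V], which the carriers
   of the two probabilistic spaces do not inherit. *)
pose S : {linear V -> V} := T.
have -> : continuous T <-> continuous S.
  split=> cT q B.
    by have := cT q B; rewrite /nbhs /= !strong_nbhsE.
  by have := cT q B; rewrite /nbhs /= !strong_nbhsE.
rewrite -linear_bounded_continuous -bounded_funP; split=> [bS A|bT r].
  rewrite !pn_boundedP// => -[M AM]; have [N SN] := bS M.
  by exists N => _ [p Ap <-]; apply: SN; exact: AM.
have : pn_bounded (X := alpha_simple V G alpha_gt0) [set p : V | `|p| <= r].
  by rewrite pn_boundedP//; exists r.
move=> /bT; rewrite pn_boundedP// => -[N TN].
by exists N => x xr; apply: TN; exists x.
Qed.
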